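(* Let $n>0$ be an integer and let $\delta,d$ be reals with $0<\delta<1/4$, $d\ge 2^{4/\delta}$ and $n^{\delta}\ge \frac{2^{14}\log n}{\delta^2}$. Then, in the Distanced Matching Game with parameters $n,\delta,d$, the number of iterations is at most $n^{8\delta}$, regardless of the strategies of the Distancing Player and of the Matching Player.
   Context: All graphs are simple, undirected and unweighted; logarithms are base $2$; $\mathrm{dist}_G(A,B)$ is the minimum length (number of edges) of a path in $G$ between a vertex of $A$ and a vertex of $B$. For an $n$-vertex graph $G$ and parameters $0<\delta<1$, $d>0$, a $(\delta,d)$-distancing in $G$ is a triple $(A,B,E')$ where $A,B\subseteq V(G)$ are disjoint, $|A|=|B|\ge n^{1-\delta}$, $E'\subseteq E(G)$ with $|E'|\le |A|/16$, and $\mathrm{dist}_{G\setminus E'}(A,B)\ge d$. The Distanced Matching Game with parameters $n,\delta,d$ is played between a Distancing Player and a Matching Player. It starts with a graph $G$ on a fixed set of $n$ vertices and no edges. In iteration $i$, the Distancing Player either returns a $(\delta,d)$-distancing $(A_i,B_i,E'_i)$ in the current graph $G$, or returns ``END'' (in which case the game terminates and is said to have lasted $i-1$ iterations); if no $(\delta,d)$-distancing exists in $G$, the game must terminate. Otherwise the Matching Player returns a matching $M_i\subseteq A_i\times B_i$ (a set of vertex pairs, each vertex in at most one pair) with $|M_i|\ge |A_i|/8$ containing no pair $(u,v)$ for which $(u,v)\in E'_i$; the pairs of $M_i$ are added to $G$ as edges, and the game proceeds to the next iteration. *)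

(* Defs.v *)
From mathcomp Require Import all_boot all_order all_algebra.
From mathcomp Require Import all_classical all_reals all_analysis.

Set Implicit Arguments.
Unset Strict Implicit.
Unset Printing Implicit Defensive.

Import Order.TTheory GRing.Theory Num.Theory.

Local Open Scope ring_scope.

Definition log2 (R : realType) (x : R) : R := ln x / ln 2.

(* A simple graph on the vertex set T is represented by its edge set, an edge
   {x, y} being the two-element set [set x; y]. *)
Definition adj (T : finType) (E : {set {set T}}) : rel T :=
  fun x y => (x != y) && ([set x; y]%SET \in E).

(* A path is given by its first vertex x and the sequence p of the following
   ones, so that its number of edges is size p. The distance is +oo when no
   path joins A to B. *)
Definition dist (R : realType) (T : finType) (E : {set {set T}})
    (A B : {set T}) : \bar R :=
  ereal_inf [set l : \bar R | exists (x : T) (p : seq T),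
    [/\ x \in A, last x p \in B, path (adj E) x p, uniq (x :: p)
      & l = (size p)%:R%:E]]%classic.

Record distancing (T : finType) := Distancing {
  dA : {set T};
  dB : {set T};
  dE : {set {set T}}
}.

Definition is_distancing (R : realType) (T : finType) (delta d : R)
    (E : {set {set T}}) (t : distancing T) : Prop :=
  [/\ [disjoint dA t & dB t],
      #|dA t| = #|dB t|,
      #|T|%:R `^ (1 - delta) <= #|dA t|%:R :> R,
      dE t \subset E /\ #|dE t|%:R <= #|dA t|%:R / 16%:R :> R
    & (d%:E <= dist R (E :\: dE t)%SET (dA t) (dB t))%E].

Definition is_matching (T : finType) (M : {set T * T}) : Prop :=
  forall v : T, (#|[set p in M | (p.1 == v) || (p.2 == v)]%SET| <= 1)%N.

Definition legal_matching (R : realType) (T : finType) (t : distancing T)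
    (M : {set T * T}) : Prop :=
  [/\ M \subset finset.setX (dA t) (dB t),
      is_matching M,
      #|dA t|%:R / 8%:R <= #|M|%:R :> R
    & forall u v : T, (u, v) \in M -> [set u; v]%SET \notin dE t].

Definition round (T : finType) : Type := (distancing T * {set T * T})%type.

(* The completed iterations, in chronological order. *)
Definition history (T : finType) : Type := seq (round T).

Definition graph_of (T : finType) (h : history T) : {set {set T}} :=
  (\bigcup_(r <- h) [set [set p.1; p.2] | p in r.2])%SET.

(* None stands for the answer END. *)
Definition distancing_player (T : finType) : Type :=
  history T -> option (distancing T).

Definition matching_player (T : finType) : Type :=
  history T -> distancing T -> {set T * T}.

Inductive reached (T : finType) (D : distancing_player T)
    (P : matching_player T) : history T -> Prop :=
| reached_start : reached D P [::]
| reached_next h t :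
    reached D P h -> D h = Some t -> reached D P (rcons h (t, P h t)).

(* Legality of moves is only required along the play of D against P, so the
   behaviour of the strategies on other histories is unconstrained. *)
Definition obeys_rules (R : realType) (T : finType) (delta d : R)
    (D : distancing_player T) (P : matching_player T) : Prop :=
  forall (h : history T) (t : distancing T),
    reached D P h -> D h = Some t ->
    is_distancing delta d (graph_of h) t /\ legal_matching R t (P h t).

Definition lasts (T : finType) (D : distancing_player T)
    (P : matching_player T) (k : nat) : Prop :=
  exists h : history T, [/\ reached D P h, D h = None & size h = k].

(* Main.v *)
(* Delete from the final graph the union X of all the sets E'_i. As
   |E'_i| <= |M_i| / 2, at least half of the matched pairs survive, and a pair
   surviving from iteration i joins vertices at distance at least d in the
   surviving graph before iteration i. Such a graph is sparse: with t about
   n^delta and r about 1 / delta, charge every surviving pair to its endpoint v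
   with the smaller value of floor(c v / t), where c v counts the earlier charges
   to v. The other endpoint brings a ball of radius m = floor(c v / t), disjoint
   from the ball of radius m + 1 around v, so by induction a vertex charged m * t
   times has t^m vertices within distance m. Since t^r > n, each vertex is charged
   fewer than r * t times, whence sum |M_i| <= 2 n r t. *)
Require Import Defs.
From mathcomp Require Import all_boot all_order all_algebra.
From mathcomp Require Import all_classical all_reals all_analysis.
From mathcomp Require Import zify ring lra.

Set Implicit Arguments.
Unset Strict Implicit.
Unset Printing Implicit Defensive.

Import Order.TTheory GRing.Theory Num.Theory.
Local Open Scope ring_scope.

(** * Balls, walks and matchings *)

Definition edge (T : finType) (p : T * T) : {set T} := [set p.1; p.2]%SET.

Definition gball (T : finType) (E : {set {set T}}) (m : nat) (x : T) : {set T} :=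
  [set y | `[< exists p, [/\ path (adj E) x p, last x p = y
                           & (size p <= m)%N] >]]%SET.

Lemma gballP (T : finType) (E : {set {set T}}) m (x y : T) :
  reflect (exists p, [/\ path (adj E) x p, last x p = y & (size p <= m)%N])
          (y \in gball E m x).
Proof. by rewrite inE; apply: asboolP. Qed.

Lemma adj_sym (T : finType) (E : {set {set T}}) : symmetric (adj E).
Proof. by move=> x y; rewrite /adj eq_sym finset.setUC. Qed.

Lemma adj_subset (T : finType) (E F : {set {set T}}) :
  E \subset F -> subrel (adj E) (adj F).
Proof. by move=> /fintype.subsetP EF x y /andP[xy /EF]; rewrite /adj xy. Qed.

Lemma gball_refl (T : finType) (E : {set {set T}}) m (x : T) :
  x \in gball E m x.
Proof. by apply/gballP; exists [::]. Qed.

Lemma gball_subset (T : finType) (E F : {set {set T}}) m (x : T) :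
  E \subset F -> gball E m x \subset gball F m x.
Proof.
move=> EF; apply/fintype.subsetP => y /gballP[p [pp py pm]]; apply/gballP; exists p.
by split=> //; apply: sub_path pp; apply: adj_subset.
Qed.

Lemma gball_adj (T : finType) (E : {set {set T}}) m (x y : T) :
  adj E x y -> gball E m y \subset gball E m.+1 x.
Proof.
move=> xy; apply/fintype.subsetP => z /gballP[p [pp pz pm]]; apply/gballP.
by exists (y :: p); rewrite /= xy.
Qed.

Lemma gball_trans (T : finType) (E : {set {set T}}) a b (x y z : T) :
  z \in gball E a x -> z \in gball E b y -> y \in gball E (a + b) x.
Proof.
move=> /gballP[p [pp pz pa]] /gballP[q [qq qz qb]]; apply/gballP.
(* The second walk is run backwards: [rev (belast y q)] lists its vertices after [z], down to
   [y]. *)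
exists (p ++ rev (belast y q)); split.
- rewrite cat_path pp /= pz -qz rev_path.
  by apply: sub_path qq => u v; rewrite /= adj_sym.
- rewrite last_cat pz -qz.
  by case: q {qq qz qb} => [|u q] //=; rewrite rev_cons last_rcons.
- by rewrite size_cat size_rev size_belast leq_add.
Qed.

(** Balls are made of arbitrary walks while [dist] ranges over simple paths; shortening a walk keeps
    its endpoints and does not lengthen it. *)
Lemma dist_path_ge (R : realType) (T : finType) (E : {set {set T}})
    (A B : {set T}) (d : R) (x : T) (p : seq T) :
  (d%:E <= dist R E A B)%E -> x \in A -> last x p \in B ->
  path (adj E) x p -> d <= (size p)%:R.
Proof.
move=> dd xA lB pp; move: lB; case/shortenP: pp => q pq uq sq lB.
have {}sq : (size q <= size p)%N.
  by apply: uniq_leq_size sq; case/andP: uq.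
rewrite (@le_trans _ _ (size q)%:R) ?ler_nat// -lee_fin (le_trans dd)//.
by apply: ereal_inf_lbound; exists x, q.
Qed.

Lemma matching_inj (T : finType) (M : {set T * T}) (v : T) (p q : T * T) :
  is_matching M -> p \in M -> q \in M ->
  v \in edge p -> v \in edge q -> p = q.
Proof.
rewrite !inE !(eq_sym v) => /(_ v) /card_le1_eqP H pM qM vp vq.
by apply: H; rewrite inE ?pM ?qM.
Qed.

Lemma edge_inj (T : finType) (M : {set T * T}) :
  is_matching M -> {in M &, injective (@edge T)}.
Proof.
move=> Mm p q pM qM pq.
by apply: (@matching_inj _ M p.1) => //; rewrite -?pq /edge !inE eqxx.
Qed.

Lemma gball_leq (T : finType) (E : {set {set T}}) m1 m2 (x : T) :
  (m1 <= m2)%N -> gball E m1 x \subset gball E m2 x.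
Proof.
move=> m12; apply/fintype.subsetP => y /gballP[p [pp py pm]]; apply/gballP; exists p.
by split=> //; apply: leq_trans m12.
Qed.

Lemma gball_sym (T : finType) (E : {set {set T}}) m (x y : T) :
  (y \in gball E m x) = (x \in gball E m y).
Proof.
by apply/idP/idP => h; have := gball_trans (gball_refl E 0 _) h; rewrite add0n.
Qed.

(** * Charges and the growth of balls *)

(* Each unit of the counter [c v] between [m * t] and [m.+1 * t] accounts for
   one more ball of [t ^ m] vertices, disjoint from the earlier ones and inside
   the ball of radius [m.+1] around [v]. *)
Definition growing (T : finType) (t : nat) (E : {set {set T}}) (c : T -> nat) :=
  forall v m q, (q <= t)%N -> (m * t + q <= c v)%N ->
    (q * t ^ m <= #|gball E m.+1 v|)%N.

(** For positive [m] this is a complete batch, [q = t], at the level below. *)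
Lemma growing_exp (T : finType) t (E : {set {set T}}) (c : T -> nat) v m :
  growing t E c -> (m * t <= c v)%N -> (t ^ m <= #|gball E m v|)%N.
Proof.
move=> gc; case: m => [_|m mt].
  by rewrite expn0 card_gt0; apply/set0Pn; exists v; apply: gball_refl.
by rewrite expnS; apply: gc => //; rewrite addnC -mulSn.
Qed.

Lemma growing_ltn (T : finType) t r (E : {set {set T}}) (c : T -> nat) v :
  growing t E c -> (#|T| < t ^ r)%N -> (c v < r * t)%N.
Proof.
move=> gc Tr; rewrite ltnNge; apply/negP => /(growing_exp gc) h.
by have := leq_trans Tr (leq_trans h (max_card _)); rewrite ltnn.
Qed.

(** Balls are compared in the old graph [E], so the pairs of [N] do not interfere; as [N] is a
    matching, each counter rises by at most one. *)
Lemma growing_step (T : finType) t r (E F : {set {set T}}) (N : {set T * T})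
    (c : T -> nat) :
  E \subset F -> is_matching N -> (0 < t)%N -> (#|T| < t ^ r)%N ->
  (forall p, p \in N -> adj F p.1 p.2) ->
  (forall p, p \in N -> p.2 \notin gball E (2 * r).-1 p.1) ->
  growing t E c ->
  exists2 c' : T -> nat, growing t F c' &
    (\sum_v c v + #|N| <= \sum_v c' v)%N.
Proof.
move=> EF Nm t0 Tr Nadj Nfar gc.
(* Charging the endpoint of lower level ensures that the other endpoint already has a ball of
   [t ^ m] vertices, where [m] is the level of the charged one. *)
pose low (p : T * T) := if (c p.1 %/ t <= c p.2 %/ t)%N then p.1 else p.2.
have low_edge p : low p \in edge p.
  by rewrite /low /edge !inE; case: ifP; rewrite eqxx ?orbT.
have low_inj : {in N &, injective low}.
  move=> p q pN qN pq; apply: (@matching_inj _ N (low p)) => //.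
  by rewrite pq.
have lowP p : p \in N -> exists w, [/\ (c (low p) %/ t <= c w %/ t)%N,
    adj F (low p) w & w \notin gball E (2 * r).-1 (low p)].
  move=> pN; rewrite /low; case: leqP => h.
    by exists p.2; rewrite Nadj ?Nfar.
  by exists p.1; rewrite adj_sym Nadj // gball_sym Nfar // ltnW.
exists (fun v => c v + (v \in low @: N))%N; last first.
  rewrite big_split /= -(card_in_imset low_inj) leq_add2l -sum1_card.
  by rewrite big_mkcond leq_sum // => v _; case: (v \in _).
move=> v m q qt; have EFv := subset_leq_card (gball_subset m.+1 v EF).
have [/imsetP[p pN vE]|_] := boolP (v \in _); last first.
  by rewrite addn0 => h; apply: leq_trans (gc _ _ _ _ h) EFv.
(* Only equality uses the new charge; below it the old counter of [v] suffices. *)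
rewrite addn1 leq_eqVlt => /orP[/eqP mqc|h]; last first.
  by apply: leq_trans (gc _ _ _ _ h) EFv.
case: q qt mqc => [|q] qt; first by rewrite mul0n.
rewrite addnS => -[mqc].
have [w [cvw vw wfar]] := lowP _ pN; rewrite -vE in cvw vw wfar.
have cvE : (c v %/ t = m)%N by rewrite -mqc divnMDl // divn_small ?addn0.
have mtw : (m * t <= c w)%N.
  by apply: leq_trans (leq_trunc_div _ t); rewrite leq_mul2r -cvE cvw orbT.
have mr : (m < r)%N.
  rewrite -(@ltn_pmul2r t) //; apply: leq_ltn_trans (growing_ltn v gc Tr).
  by rewrite -mqc leq_addr.
(* A common vertex would put [w] within [m.+1 + m] of [v], which is at most [(2 * r).-1] since
   [m < r]. *)
have dvw : [disjoint gball E m.+1 v & gball E m w].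
  apply/pred0P => z /=; apply/negP => /andP[zv zw].
  case/negP: wfar; apply: fintype.subsetP (gball_trans zv zw); apply: gball_leq; lia.
rewrite mulSn addnC.
have hq : (q * t ^ m <= #|gball E m.+1 v|)%N by apply: gc; lia.
apply: leq_trans (leq_add hq (growing_exp gc mtw)) _.
move: (leq_card_setU (gball E m.+1 v) (gball E m w)).2; rewrite dvw => /eqP <-.
apply: subset_leq_card; rewrite finset.subUset gball_subset //=.
exact: fintype.subset_trans (gball_subset _ _ EF) (gball_adj _ vw).
Qed.

(** * Consequences of legal moves *)

Lemma graph_of_rcons (T : finType) (h : history T) (x : round T) :
  graph_of (rcons h x) = (graph_of h :|: @edge T @: x.2)%SET.
Proof. by rewrite /graph_of big_rcons. Qed.

Lemma matching_subset (T : finType) (M N : {set T * T}) :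
  N \subset M -> is_matching M -> is_matching N.
Proof.
move=> /fintype.subsetP NM Mm v; apply: leq_trans (Mm v); apply: subset_leq_card.
by apply/fintype.subsetP => p; rewrite !inE => /andP[/NM -> ->].
Qed.

(** Removing more edges than [dE t] only increases distances. Hence one fixed [X], including
    deletions of later iterations, serves the whole play. *)
Lemma legal_far (R : realType) (T : finType) (delta d : R)
    (E X : {set {set T}}) (t : distancing T) (M : {set T * T}) m p :
  is_distancing delta d E t -> legal_matching R t M -> dE t \subset X ->
  m%:R < d -> p \in M -> p.2 \notin gball (E :\: X)%SET m p.1.
Proof.
move=> [_ _ _ _ dAB] [/fintype.subsetP MAB _ _ _] tX md pM.
apply/negP => /gballP[q [qq ql qm]].
have := MAB _ pM; rewrite inE => /andP[p1A p2B].
have qE : path (adj (E :\: dE t)%SET) p.1 q.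
  by apply: sub_path qq; apply/adj_subset/finset.setDS.
rewrite -ql in p2B; have := dist_path_ge dAB p1A p2B qE.
by rewrite leNgt => /negP[]; apply: le_lt_trans md; rewrite ler_nat.
Qed.

Lemma legal_neq (R : realType) (T : finType) (delta d : R)
    (E : {set {set T}}) (t : distancing T) (M : {set T * T}) p :
  is_distancing delta d E t -> legal_matching R t M -> p \in M -> p.1 != p.2.
Proof.
move=> [dis _ _ _ _] [/fintype.subsetP MAB _ _ _] /MAB; rewrite inE => /andP[p1 p2].
by apply: contraTneq p2 => <-; rewrite (disjointFr dis).
Qed.

(** Since [M] avoids [dE t], an edge of [M] already in [E] would join the two sides by a walk of
    length one. So no edge is added twice. *)
Lemma legal_new (R : realType) (T : finType) (delta d : R)
    (E : {set {set T}}) (t : distancing T) (M : {set T * T}) p :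
  is_distancing delta d E t -> legal_matching R t M -> 1 < d ->
  p \in M -> edge p \notin E.
Proof.
move=> dt lM d1 pM; apply/negP => pE.
have [_ _ _ /(_ p.1 p.2)] := lM; rewrite -surjective_pairing => /(_ pM) pE'.
have /negP[] := legal_far (m := 1) dt lM (subxx _) d1 pM.
apply/gballP; exists [:: p.2]; split=> //=.
by rewrite /adj (legal_neq dt lM pM) inE pE' -/(edge p) pE.
Qed.

(** * Counting matched pairs along a play *)

Definition deleted (T : finType) (h : history T) : {set {set T}} :=
  (\bigcup_(x <- h) dE x.1)%SET.

Lemma play_growing (R : realType) (T : finType) (delta d : R)
    (D : distancing_player T) (P : matching_player T) t r
    (X : {set {set T}}) (h : history T) :
  obeys_rules delta d D P -> (0 < t)%N -> (#|T| < t ^ r)%N ->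
  (2 * r)%:R <= d -> reached D P h -> deleted h \subset X ->
  exists2 c : T -> nat, growing t (graph_of h :\: X)%SET c &
    (\sum_(x <- h) #|[set p in x.2 | edge p \notin X]%SET| <= \sum_v c v)%N.
Proof.
move=> rules t0 Tr rd; elim=> [_|{}h s hh IH hs].
  exists (fun=> 0%N) => [v m q _|]; last by rewrite big_nil.
  by rewrite leqn0 addn_eq0 => /andP[_ /eqP ->].
rewrite /deleted big_rcons finset.subUset => /andP[/IH[c gc cN] /= sX].
have [sd sl] := rules h s hh hs; have [_ Pm _ _] := sl.
set N := [set p in P h s | edge p \notin X]%SET.
have NP : N \subset P h s by apply/fintype.subsetP => p; rewrite inE => /andP[].
have EF : (graph_of h :\: X \subset graph_of (rcons h (s, P h s)) :\: X)%SET.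
  by rewrite graph_of_rcons finset.setSD // finset.subsetUl.
have Nadj p : p \in N -> adj (graph_of (rcons h (s, P h s)) :\: X)%SET p.1 p.2.
  rewrite inE => /andP[pP pX].
  rewrite /adj (legal_neq sd sl pP) graph_of_rcons inE -/(edge p) pX inE.
  by rewrite imset_f ?orbT.
have Nfar p : p \in N -> p.2 \notin gball (graph_of h :\: X)%SET (2 * r).-1 p.1.
  (* [r = 0] would make [T] empty, against [p.1]. Positivity of [r] puts [(2 * r).-1] strictly below
     [d]. *)
  move=> pN; have r0 : (0 < r)%N.
    case: r Tr {rd} => //; rewrite expn0 ltnS leqn0 => /eqP/card0_eq /(_ p.1).
    by rewrite inE.
  apply: (legal_far sd sl sX) (fintype.subsetP NP _ pN).
  by apply: lt_le_trans rd; rewrite ltr_nat prednK // muln_gt0.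
have [c' gc' cc'] := growing_step EF (matching_subset NP Pm) t0 Tr Nadj Nfar gc.
exists c' => //; rewrite big_rcons /=.
by apply: leq_trans cc'; rewrite leq_add2r.
Qed.

(** Added edges are distinct within a round by the matching property and across rounds by
    [legal_new], so these pairs inject into [X]. *)
Lemma play_deleted (R : realType) (T : finType) (delta d : R)
    (D : distancing_player T) (P : matching_player T)
    (X : {set {set T}}) (h : history T) :
  obeys_rules delta d D P -> 1 < d -> reached D P h ->
  (\sum_(x <- h) #|[set p in x.2 | edge p \in X]%SET| <= #|X|)%N.
Proof.
move=> rules d1 hh.
(* The induction needs the sharper bound by the edges of [X] added so far. *)
apply: leq_trans (subset_leq_card (finset.subsetIr (graph_of h) X)).
elim: hh => [|{}h s hh IH hs]; first by rewrite big_nil.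
have [sd sl] := rules h s hh hs; have [_ Pm _ _] := sl.
rewrite big_rcons graph_of_rcons /=; set N := [set p in _ | _]%SET.
have NP : N \subset P h s by apply/fintype.subsetP => p; rewrite inE => /andP[].
have eN : #|(@edge T @: N)%SET| = #|N|.
  by apply/card_in_imset/(edge_inj (matching_subset NP Pm)).
rewrite -eN.
apply: leq_trans (_ : _ <= #|graph_of h :&: X| + #|@edge T @: N|)%SET%N _.
  by rewrite leq_add2r.
have dis : [disjoint (graph_of h :&: X)%SET & (@edge T @: N)%SET].
  apply/pred0P => e /=; apply/negP => /andP[/setIP[eG _] /imsetP[p pN eE]].
  have /negP[] := legal_new sd sl d1 (fintype.subsetP NP _ pN).
  by rewrite -eE.
move: (leq_card_setU (graph_of h :&: X) (@edge T @: N))%SET.2.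
rewrite dis => /eqP <-; apply: subset_leq_card.
rewrite finset.subUset finset.setSI ?finset.subsetUl //=.
apply/fintype.subsetP => e /imsetP[p]; rewrite inE => /andP[pP pX] ->.
by rewrite !inE pX imset_f ?orbT.
Qed.

(** Both bounds use [|M_i| >= |A_i| / 8], combined with [|E'_i| <= |A_i| / 16] for the first and
    [|A_i| >= n^(1 - delta)] for the second. *)
Lemma play_sizes (R : realType) (T : finType) (delta d : R)
    (D : distancing_player T) (P : matching_player T) (h : history T) :
  obeys_rules delta d D P -> reached D P h ->
  (2 * #|deleted h| <= \sum_(x <- h) #|x.2|)%N /\
  (size h)%:R * #|T|%:R `^ (1 - delta) <= 8 * (\sum_(x <- h) #|x.2|)%:R :> R.
Proof.
move=> rules; elim=> [|{}h s hh [IHd IHs] hs].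
  by rewrite /deleted !big_nil finset.cards0 mul0r mulr0.
have [[_ _ As [_ Es] _] [_ _ Ms _]] := rules h s hh hs.
rewrite /deleted !big_rcons size_rcons /=; split.
  have : (2 * #|dE s| <= #|P h s|)%N.
    by rewrite -(ler_nat R) natrM; lra.
  have := (leq_card_setU (deleted h) (dE s)).1.
  move=> hU hE; apply: leq_trans (leq_add IHd hE).
  by rewrite -mulnDr leq_mul2l hU.
rewrite natrD -natr1 mulrDl mul1r mulrDr lerD //; lra.
Qed.

Lemma play_bound (R : realType) (T : finType) (delta d : R)
    (D : distancing_player T) (P : matching_player T) t r (h : history T) :
  obeys_rules delta d D P -> (0 < t)%N -> (0 < r)%N -> (#|T| < t ^ r)%N ->
  (2 * r)%:R <= d -> reached D P h ->
  (size h)%:R * #|T|%:R `^ (1 - delta) <= 16 * (#|T| * (r * t))%:R :> R.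
Proof.
move=> rules t0 r0 Tr rd hh; have [dM sM] := play_sizes rules hh.
apply: le_trans sM _; rewrite -!natrM ler_nat.
have d1 : 1 < d by apply: lt_le_trans rd; rewrite ltr1n; lia.
have dX := play_deleted (deleted h) rules d1 hh.
have [c gc cM] := play_growing rules t0 Tr rd hh (subxx _).
have ct : (\sum_v c v <= #|T| * (r * t))%N.
  rewrite -sum_nat_const leq_sum // => v _.
  exact/ltnW/(growing_ltn v gc Tr).
have : (\sum_(x <- h) #|x.2| =
    \sum_(x <- h) #|[set p in x.2 | edge p \in deleted h]%SET| +
    \sum_(x <- h) #|[set p in x.2 | edge p \notin deleted h]%SET|)%N.
  rewrite -big_split; apply: eq_bigr => x _ /=.
  rewrite -(cardsID [set p | edge p \in deleted h]%SET x.2).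
  by congr addn; apply: eq_card => p; rewrite !inE // andbC.
(* Pairs with a deleted edge are at most half of all, so the total is at most twice the survivors;
   with the 8 of [play_sizes] this gives 16. *)
lia.
Qed.

(** * Termination and choice of parameters *)

Lemma bounded_play_ends (T : finType) (D : distancing_player T)
    (P : matching_player T) (b : nat) :
  (forall h, reached D P h -> (size h <= b)%N) ->
  exists2 h, reached D P h & D h = None.
Proof.
move=> hb; apply: contrapT => noend.
(* A play never answered by END can always be extended, so it reaches every length. *)
have long k : exists2 h, reached D P h & size h = k.
  elim: k => [|k [h hh hk]]; first by exists [::] => //; constructor.
  case hs: (D h) => [s|]; last by case: noend; exists h.
  by exists (rcons h (s, P h s)); [constructor | rewrite size_rcons hk].
by have [h /hb + hE] := long b.+1; rewrite hE ltnn.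
Qed.

Lemma exponents_exist (R : realType) (n : nat) (delta d : R) :
  (1 < n)%N -> 0 < delta -> delta < 1 / 4%:R -> 2 `^ (4%:R / delta) <= d ->
  2 ^+ 14 * log2 (n%:R : R) / delta ^+ 2 <= n%:R `^ delta ->
  exists t r : nat, [/\ (0 < t)%N, (0 < r)%N, (n < t ^ r)%N, (2 * r)%:R <= d &
    16 * (r * t)%:R * n%:R `^ delta <= n%:R `^ (8%:R * delta) :> R].
Proof.
move=> n1 d0 d4 dd nd.
have n1R : 1 <= n%:R :> R by rewrite ler1n ltnW.
have n0R : 0 < n%:R :> R by rewrite ltr0n ltnW.
set x := n%:R `^ delta in nd *.
have x1 : 1 <= x by rewrite -(powRr0 n%:R) ler_powR // ltW.
have inv_d : 4 < delta^-1.
  by rewrite -[4]invrK ltf_pV2 ?posrE ?invr_gt0 //; lra.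
have log1 : 1 <= log2 (n%:R : R).
  rewrite /log2 ler_pdivlMr ?ln_gt0 ?ltr1n // mul1r ler_ln ?posrE //.
  by rewrite ler_nat.
have xd : 2 ^+ 14 * delta^-1 <= x.
  apply: le_trans nd; rewrite -exprVn -mulrA ler_wpM2l ?exprn_ge0 //.
  rewrite expr2 mulrA; apply: ler_peMl; first lra.
  by nra.
pose r := (Num.truncn delta^-1).+1; pose t := (Num.truncn x).+1.
have /andP[rl ru] := truncn_itv (ltW (lt_trans (ltr0n R 4) inv_d)).
have /andP[tl tu] := truncn_itv (le_trans ler01 x1).
rewrite -/r -/t in ru tu.
have rlt : r%:R <= delta^-1 + 1 by rewrite /r -natr1 lerD2r.
have tlt : t%:R <= x + 1 by rewrite /t -natr1 lerD2r.
exists t, r; split=> //.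
- rewrite -(ltr_nat R) natrX.
  have -> : n%:R = x `^ delta^-1 :> R by rewrite -powRrM divff ?gt_eqF // powRr1.
  (* Rounding up strictly gives [n = x^(1 / delta) <= x^r < t^r]. *)
  apply: le_lt_trans (_ : x `^ r%:R < _).
    by rewrite ler_powR // ltW.
  rewrite powR_mulrn ?(le_trans ler01) // ltr_pXn2r // ?nnegrE //.
  exact: le_trans ler01 _.
(* Here [2 r < 2^(2 r)] and [2 r <= 2 / delta + 2 <= 4 / delta]. *)
- apply: le_trans dd; apply: le_trans (_ : 2 `^ (2 * r)%:R <= _).
    by rewrite powR_mulrn // -natrX ler_nat ltnW // ltn_expl.
  by rewrite ler_powR ?ler1n // natrM; lra.
- have -> : n%:R `^ (8 * delta) = x ^+ 8.
    by rewrite mulrC powRrM powR_mulrn // powR_ge0.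
  rewrite natrM.
  (* From [r <= 2 / delta] and [t <= 2 x], the left side is at most [(64 / delta) x^2 <= x^3]. *)
  have : (r%:R : R) * t%:R <= (2 * delta^-1) * (2 * x).
    by apply: ler_pM => //; lra.
  have x3 : x ^+ 3 <= x ^+ 8 by rewrite ler_weXn2l.
  move=> rt; apply: le_trans x3.
  have -> : x ^+ 3 = x * x * x by ring.
  apply: ler_wpM2r; first lra.
  apply: le_trans (_ : 64 * delta^-1 * x <= _); first by lra.
  by apply: ler_wpM2r; lra.
Qed.

Theorem theorem2p1 (R : realType) (n : nat) (T : finType) (delta d : R)
    (n_gt0 : (0 < n)%N) (cardT : #|T| = n)
    (delta_gt0 : 0 < delta) (delta_lt : delta < 1 / 4%:R)
    (d_ge : 2 `^ (4%:R / delta) <= d)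
    (n_ge : 2 ^+ 14 * log2 (n%:R : R) / delta ^+ 2 <= n%:R `^ delta)
    (D : distancing_player T) (P : matching_player T)
    (rules : obeys_rules delta d D P) :
  exists k : nat, lasts D P k /\ k%:R <= n%:R `^ (8%:R * delta).
Proof.
suff bnd h : reached D P h -> (size h)%:R <= n%:R `^ (8%:R * delta) :> R.
  pose b := Num.truncn (n%:R `^ (8%:R * delta) : R).
  have [|h hh hE] := @bounded_play_ends T D P b.
    by move=> h /bnd; rewrite truncn_ge_nat ?powR_ge0.
  by exists (size h); split; [exists h | exact: bnd].
(* For [n = 1] the logarithm vanishes and [n_ge] gives no lower bound on [n^delta] in terms of
   [1 / delta]; this case is treated directly. *)
have [n1|n1] := ltnP 1 n.
  have [t [r [t0 r0 nr rd hexp]]] :=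
    exponents_exist n1 delta_gt0 delta_lt d_ge n_ge.
  rewrite -cardT in nr => hh; apply: le_trans hexp.
  have := play_bound rules t0 r0 nr rd hh; rewrite cardT natrM.
  have n0R : 0 < n%:R :> R by rewrite ltr0n.
  have pE : n%:R `^ (1 - delta) * n%:R `^ delta = n%:R :> R.
    by rewrite -powRD ?subrK ?powRr1 ?oner_eq0 // ltW.
  have p0 : 0 < n%:R `^ (1 - delta) :> R by rewrite powR_gt0.
  (* Splitting the factor [n] on the right lets [n^(1 - delta)] cancel. *)
  rewrite -[X in _ <= 16 * (X * _)]pE => hb.
  rewrite -(ler_pM2r p0); apply: le_trans hb _.
  by rewrite le_eqVlt; apply/predU1P; left; ring.
have nE : n = 1%N by lia.
(* No iteration is possible: disjoint nonempty [A] and [B] need two vertices. *)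
case=> [|{}h s hh hs]; first exact: powR_ge0.
have [[dis AB As _ _] _] := rules h s hh hs.
move: As; rewrite cardT nE powR1 ler1n => A0.
have := max_card (mem (dA s :|: dB s)%SET); rewrite cardT nE.
move: (leq_card_setU (dA s) (dB s)).2; rewrite dis => /eqP ->.
by rewrite -AB; lia.
Qed.
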